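(* $m(3,2)=\binom{8}{3}=56$. That is, the maximum of $|\mathcal{F}|$ over all positive integers $n$ and all $2$-resilient families $\mathcal{F}\subset\binom{[n]}{3}$ with matching number $\nu(\mathcal{F})=2$ equals $56$.
   Context: $[n]=\{1,\dots,n\}$ and $\binom{[n]}{k}$ is the family of all $k$-element subsets of $[n]$; a family $\mathcal{F}\subset\binom{[n]}{k}$ is called a $k$-graph. The matching number $\nu(\mathcal{F})$ is the maximum number of pairwise disjoint members of $\mathcal{F}$. For $T\subset[n]$, $\mathcal{F}(\overline{T})=\{F\in\mathcal{F}: F\cap T=\emptyset\}$. A $k$-graph $\mathcal{F}\subset\binom{[n]}{k}$ is $t$-resilient if $\nu(\mathcal{F}(\overline{T}))=\nu(\mathcal{F})$ for every $T\subset[n]$ with $|T|\le t$. For positive integers $k,s$, $m(k,s)$ denotes the maximum of $|\mathcal{F}|$ over all $(k-1)$-resilient $k$-graphs $\mathcal{F}$ (on $[n]$, for any $n$) with $\nu(\mathcal{F})=s$. *)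

(* Defs.v *)
From mathcomp Require Import all_boot.

Set Implicit Arguments.
Unset Strict Implicit.
Unset Printing Implicit Defensive.

(* The ground set [n] = {1, ..., n} is represented by 'I_n = {0, ..., n - 1}. *)

Definition kgraph (n k : nat) (F : {set {set 'I_n}}) : bool :=
  [forall A in F, #|A| == k].

Definition matching_number (n : nat) (F : {set {set 'I_n}}) : nat :=
  \max_(M in powerset F | trivIset M) #|M|.

Definition avoiding (n : nat) (F : {set {set 'I_n}}) (T : {set 'I_n}) :
    {set {set 'I_n}} :=
  [set A in F | A :&: T == set0].

Definition resilient (n t : nat) (F : {set {set 'I_n}}) : Prop :=
  forall T : {set 'I_n}, #|T| <= t ->
    matching_number (avoiding F T) = matching_number F.

Definition admissible (k s n : nat) (F : {set {set 'I_n}}) : Prop :=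
  [/\ kgraph k F, resilient k.-1 F & matching_number F = s].

(* [is_m k s v] means m(k,s) = v.  It is a relation because the maximum ranges
   over all n, so its existence is not automatic. *)
Definition is_m (k s v : nat) : Prop :=
  (exists n : nat, 0 < n /\
     exists F : {set {set 'I_n}}, admissible k s F /\ #|F| = v) /\
  (forall n : nat, 0 < n ->
     forall F : {set {set 'I_n}}, admissible k s F -> #|F| <= v).

(* Main.v *)
(* Let F be admissible, let A, B be disjoint edges and U = A :|: B, so that every
   edge meets U.  By its trace on U, an edge is a triple of U, a pair p of U with
   one of h(p) "outer" points, or a vertex f of U with a set of its "link", a
   graph outside U with g(f) edges.  That no three edges are disjoint and that
   two disjoint edges survive the deletion of any two points constrain these
   numbers: h(p) <= 4, links have maximum degree at most 3, and h and g are
   small on the complement of a triple belonging to F.  In the integer program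
   given by these constraints only the level of g(f) matters, i.e. whether it is
   0, 1, 2-3, 4-6 or at least 7.

   For fixed levels, 9 times the number of edges with at least two points in U
   is the sum over the 15 perfect matchings of K_6 of a local quantity, which
   involves the three pairs of the matching and the 12 triples that consist of
   a pair of the matching and a further point.  The sum of the local maxima
   shows |F| <= 56 for nearly all levels, and a short branch and bound, run
   inside the kernel, deals with the others. *)

Require Import Defs.
From mathcomp Require Import all_boot zify.

Set Implicit Arguments.
Unset Strict Implicit.
Unset Printing Implicit Defensive.

(** * The integer program *)

(* The order keeps the search below small. *)
Definition pairs : seq (nat * nat) :=
  [:: (0,3); (1,4); (2,5); (0,4); (1,5); (2,3); (0,5); (1,3); (2,4);
      (0,1); (0,2); (1,2); (3,4); (3,5); (4,5)].

Definition pair_at (i : nat) : nat * nat := nth (0, 0) pairs i.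

Definition triples : seq (seq nat) :=
  [seq s <- [seq [:: ij.1; ij.2; k] | ij <- [seq (i, j) | i <- iota 0 6, j <- iota 0 6],
                                      k <- iota 0 6] | sorted ltn s].

Definition hexad (p q r : nat * nat) : seq nat :=
  [:: p.1; p.2; q.1; q.2; r.1; r.2].

(* A perfect matching of K_6, given by the increasing positions of its three
   edges in [pairs]. *)
Definition perfect_matchings : seq (nat * nat * nat) :=
  [seq m <- [seq (ij, k) | ij <- [seq (i, j) | i <- iota 0 15, j <- iota 0 15],
                           k <- iota 0 15]
  | [&& m.1.1 < m.1.2, m.1.2 < m.2 &
     uniq (hexad (pair_at m.1.1) (pair_at m.1.2) (pair_at m.2))]].

(* For U = abcdef with abc in F, at most [threshold (level #|link f|)] edges of F
   have trace de on U: the third point of such an edge lies in every set of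
   [link f], and no point outside U lies in more than three of these sets. *)
Definition threshold (l : nat) : nat :=
  match l with 0 => 4 | 1 => 2 | 2 => 1 | _ => 0 end.

(* [is0], [is4] and [Nat.leb] instead of the boolean operations of [ssrnat]:
   kernel conversion without the virtual machine evaluates them much faster. *)
Definition is0 (n : nat) : bool := if n is 0 then true else false.
Definition is4 (n : nat) : bool := if n is 4 then true else false.

Section Search.
Variable l : nat -> nat.

(* Here and below, [l i] is the level of the vertex i of U = {0, ..., 5}.  If the
   complement of abc is an edge of F, then the links of a, b and c are
   cross-intersecting, so that a link of level 4 forces the others to be empty. *)
Definition crowded (a b c : nat) : bool :=
  if is4 (l a) then ~~ is0 (l b + l c) else
  if is4 (l b) then ~~ is0 (l a + l c) else
  if is4 (l c) then ~~ is0 (l a + l b) else false.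

(* Necessary conditions for xq to be an edge of F, when U = xqfr and the pairs q
   and r have [hq] and [hr] extensions outside U.  If [hq = 4], then two disjoint
   edges avoiding q contain these 4 points and one point of U each; xq meets one
   of these edges, hence in x, and so [link x] is not empty. *)
Definition edge_ok (x hq f hr : nat) (r : nat * nat) : bool :=
  if Nat.leb hr (threshold (l f)) then
    if (if is4 hq then is0 (l x) else false) then false else ~~ crowded f r.1 r.2
  else false.

Definition edges_ok (p : nat * nat) (hq hr : nat) (r : nat * nat) : nat :=
  edge_ok p.2 hq p.1 hr r + edge_ok p.1 hq p.2 hr r.

(* Three disjoint pairs with at least 1, 2 and 3 extensions extend to three
   disjoint edges. *)
Definition rainbow (x y z : nat) : bool :=
  match x, y, z with S _, S (S _), S (S (S _)) => true | _, _, _ => false end.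

(* Two disjoint pairs with at least 3 and 4 extensions and a set in the link of a
   vertex of r give three disjoint edges. *)
Definition large (x y : nat) (r : nat * nat) : bool :=
  match x, y with
  | S (S (S x')), S (S (S y')) => if is0 (x' + y') then false else ~~ is0 (l r.1 + l r.2)
  | _, _ => false
  end.

Definition matching_ok (p q r : nat * nat) (x y z : nat) : bool :=
  ~~ [|| rainbow x y z, rainbow x z y, rainbow y x z, rainbow y z x,
         rainbow z x y, rainbow z y x, large y z p, large x z q | large x y r].

(* Shifted by one, 0 being the value of an infeasible triple (x, y, z). *)
Definition local_max (p q r : nat * nat) (x y z : nat) : nat :=
  if matching_ok p q r x y z then
    (edges_ok p y z r + edges_ok p z y q + edges_ok q x z r + edges_ok q z x p
     + edges_ok r x y q + edges_ok r y x p + 3 * (x + y + z)).+1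
  else 0.

(* For a pair inside 012 or inside 345, [threshold] applies, since the other one
   of these two triples is an edge. *)
Definition cap (p : nat * nat) : nat :=
  if Nat.leb p.2 2 then threshold (l (3 - p.1 - p.2)) else
  if Nat.leb 3 p.1 then threshold (l (12 - p.1 - p.2)) else 4.

Definition maxs (s : seq nat) : nat := foldr maxn 0 s.

(** A trie node carries the maximum over its subtree, so that a partial assignment gets the best
    value among its completions by a single lookup. *)
Definition node (T : Type) (f : T -> nat) (s : seq T) : nat * seq T :=
  (maxs [seq f x | x <- s], s).

Definition trie := (nat * seq (nat * seq (nat * seq nat)))%type.

Definition table (m : nat * nat * nat) : trie :=
  let p := pair_at m.1.1 in let q := pair_at m.1.2 in let r := pair_at m.2 in
  node fst [seq node fst [seq node id [seq local_max p q r x y z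
    | z <- iota 0 (cap r).+1] | y <- iota 0 (cap q).+1] | x <- iota 0 (cap p).+1].

(** Index 0 means unassigned. Positions increase within a perfect matching and pairs are assigned in
    order, so the unassigned coordinates form a suffix. *)
Definition lookup (t : trie) (i j k : nat) : nat :=
  if i is x.+1 then
    let t1 := nth (0, [::]) t.2 x in
    if j is y.+1 then
      let t2 := nth (0, [::]) t1.2 y in
      if k is z.+1 then nth 0 t2.2 z else t2.1
    else t1.1
  else t.1.

Definition splits (s : seq nat) : seq (nat * (nat * nat)) :=
  let a := nth 0 s 0 in let b := nth 0 s 1 in let c := nth 0 s 2 in
  [:: (a, (b, c)); (b, (a, c)); (c, (a, b))].

Definition complement (s : seq nat) : seq nat := [seq i <- iota 0 6 | i \notin s].

(** At a leaf a triple must pass all nine conditions at once, whereas the local maxima test each of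
    them only in its own perfect matching. *)
Definition triple_ok (h : nat * nat -> nat) (s : seq nat) : bool :=
  all (fun u => all (fun v => edge_ok u.1 (h u.2) v.1 (h v.2) v.2)
                    (splits (complement s))) (splits s).

(* [hs] lists the values, shifted by one, assigned to the first pairs, so that
   [nth 0 hs i = 0] when the i-th pair is unassigned.  The 15 values of [vals] are
   shifted by one as well, and their sum bounds 9 times the weight: whence
   9 * target + 8 + 15. *)
Fixpoint search (tabs : seq ((nat * nat * nat) * trie)) (target : nat)
    (todo : seq (nat * nat)) (hs : seq nat) : bool :=
  let vals := [seq lookup mt.2 (nth 0 hs mt.1.1.1) (nth 0 hs mt.1.1.2) (nth 0 hs mt.1.2)
              | mt <- tabs] in
  if (0 \in vals) || (sumn vals <= 9 * target + 23) then true else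
  if todo is p :: todo' then
    all (fun v => search tabs target todo' (rcons hs v)) (iota 1 (cap p).+1)
  else
    let h p := (nth 0 hs (index p pairs)).-1 in
    sumn [seq h p | p <- pairs] + count (triple_ok h) triples <= target.

End Search.

(* Bounds the sum of three link sizes of levels a >= b >= c, for the vertices of
   an edge whose complement in U is an edge. *)
Definition side_bound (a b c : nat) : nat :=
  if is4 a then 9 else
  let s := [:: a; b; c] in
  let n3 := count_mem 3 s in let n2 := count_mem 2 s in let n1 := count_mem 1 s in
  if (n3 == 1) && (n2 == 0) then 6 + n1 else 4 * n3 + 3 * n2 + n1.

Definition sides : seq (nat * nat * nat) :=
  [seq m <- [seq (ij, k) | ij <- [seq (i, j) | i <- iota 0 5, j <- iota 0 5],
                           k <- iota 0 5]
  | [&& m.1.2 <= m.1.1, m.2 <= m.1.2 & (m.1.1 == 4) ==> (m.1.2 == 0)]].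

(* Level 4 is impossible with fewer than three nonempty links: see [link_gt6]. *)
Definition check (x y : nat * nat * nat) : bool :=
  let ls := [:: x.1.1; x.1.2; x.2; y.1.1; y.1.2; y.2] in
  let l := nth 0 ls in
  if (4 \in ls) && (count (fun i => 0 < i) ls <= 2) then true else
  search l [seq (m, table l m) | m <- perfect_matchings]
    (56 - side_bound x.1.1 x.1.2 x.2 - side_bound y.1.1 y.1.2 y.2) pairs [::].

Lemma check_all : all (fun x => all (check x) sides) sides.
Proof. by vm_compute. Qed.

(** Reduces a permutation of explicit lists to a linear identity in the unknowns [p x], which [lia]
    proves. *)
Lemma perm_sumnP (T : eqType) (s1 s2 : seq T) :
  (forall p : T -> nat, sumn [seq p x | x <- s1] = sumn [seq p x | x <- s2]) -> perm_eq s1 s2.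
Proof.
by move=> E; apply/permP=> P; have := E (fun x => P x : nat); rewrite -!sumn_count.
Qed.

Lemma sumn_linear (T : Type) (f f' : T -> nat) (k : nat) (s : seq T) :
  sumn [seq f x + k * f' x | x <- s] = sumn [seq f x | x <- s] + k * sumn [seq f' x | x <- s].
Proof. by elim: s => [|x s /= ->]; rewrite ?muln0 // mulnDr addnACA. Qed.

Lemma leq_count_in (T : eqType) (P Q : pred T) (s : seq T) :
  {in s, forall x, P x -> Q x} -> count P s <= count Q s.
Proof.
elim: s => //= x s IH PQ; apply: leq_add; last first.
  by apply: IH => y sy; apply: PQ; rewrite inE sy orbT.
by have := PQ x (mem_head _ _); case: (P x) => // ->.
Qed.

(** * Soundness of the search *)

Section Soundness.
Variables (l : nat -> nat) (t : seq nat -> bool) (h : nat * nat -> nat).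
Hypothesis t_perm : forall s1 s2, perm_eq s1 s2 -> t s1 = t s2.
Hypothesis h_le4 : forall p, h p <= 4.
Hypothesis edge_okP : forall (x : nat) (q : nat * nat) (f : nat) (r : nat * nat),
  uniq (x :: q.1 :: q.2 :: f :: r.1 :: r.2 :: [::]) ->
  all (ltn^~ 6) (x :: q.1 :: q.2 :: f :: r.1 :: r.2 :: [::]) ->
  t [:: x; q.1; q.2] -> edge_ok l x (h q) f (h r) r.
Hypothesis matching_okP : forall p q r, uniq (hexad p q r) -> all (ltn^~ 6) (hexad p q r) ->
  matching_ok l p q r (h p) (h q) (h r).
Hypothesis tA : t [:: 0; 1; 2].
Hypothesis tB : t [:: 3; 4; 5].

Lemma pairs_lt p : p \in pairs -> [&& p.1 < p.2, p.1 < 6 & p.2 < 6].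
Proof. by move: p; apply/allP. Qed.

Lemma h_le_threshold f (q : nat * nat) (r : nat * nat) x :
  uniq (x :: q.1 :: q.2 :: f :: r.1 :: r.2 :: [::]) ->
  all (ltn^~ 6) (x :: q.1 :: q.2 :: f :: r.1 :: r.2 :: [::]) ->
  t [:: x; q.1; q.2] -> h r <= threshold (l f).
Proof.
move=> U L T; have := edge_okP U L T; rewrite /edge_ok.
by case: ifP => // /PeanoNat.Nat.leb_le; lia.
Qed.

Lemma h_le_cap p : p \in pairs -> h p <= cap l p.
Proof.
rewrite /pairs !inE.
do ![case/orP=> [/eqP-> | ] | move/eqP-> ]; rewrite /cap /=; try exact: h_le4.
all: try by apply: (@h_le_threshold _ (4, 5) _ 3).
all: by apply: (@h_le_threshold _ (1, 2) _ 0).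
Qed.

Lemma nth_le_maxs (s : seq nat) i : nth 0 s i <= maxs s.
Proof.
elim: s i => [|a s IH] [|i] //=; first exact: leq_maxl.
exact: leq_trans (IH i) (leq_maxr _ _).
Qed.

Lemma le_node (T : Type) (f : T -> nat) (g : nat -> T) n a : a <= n ->
  f (g a) <= (node f [seq g b | b <- iota 0 n.+1]).1.
Proof.
move=> le_an; have := nth_le_maxs [seq f x | x <- [seq g b | b <- iota 0 n.+1]] a.
by rewrite (nth_map (g 0)) ?size_map ?size_iota // (nth_map 0) ?size_iota // nth_iota.
Qed.

Lemma lookup_ge m (x y z : nat) i j k :
  x <= cap l (pair_at m.1.1) -> y <= cap l (pair_at m.1.2) -> z <= cap l (pair_at m.2) ->
  [\/ [/\ i = x.+1, j = y.+1 & k = z.+1], [/\ i = x.+1, j = y.+1 & k = 0],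
      [/\ i = x.+1, j = 0 & k = 0] | [/\ i = 0, j = 0 & k = 0]] ->
  local_max l (pair_at m.1.1) (pair_at m.1.2) (pair_at m.2) x y z <=
    lookup (table l m) i j k.
Proof.
move=> hx hy hz; set p := pair_at _; set q := pair_at _; set r := pair_at _.
pose t2 x y := node id [seq local_max l p q r x y z | z <- iota 0 (cap l r).+1].
pose t1 x := node fst [seq t2 x y | y <- iota 0 (cap l q).+1].
have nthE (T : Type) (d : T) f n a : a <= n -> nth d [seq f b | b <- iota 0 n.+1] a = f a.
  by move=> le_an; rewrite (nth_map 0) ?size_iota // nth_iota.
have le2 : local_max l p q r x y z <= (t2 x y).1 by exact: (le_node id _ hz).
have le1 : (t2 x y).1 <= (t1 x).1 by exact: (le_node fst _ hy).
have le0 : (t1 x).1 <= (table l m).1 by exact: (le_node fst _ hx).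
have n1 : nth (0, [::]) (table l m).2 x = t1 x by rewrite [LHS]nthE.
have n2 : nth (0, [::]) (t1 x).2 y = t2 x y by rewrite [LHS]nthE.
have n3 : nth 0 (t2 x y).2 z = local_max l p q r x y z by rewrite [LHS]nthE.
case=> -[Ei Ej Ek]; subst i j k; rewrite /lookup ?n1 ?n2 ?n3 //.
- exact: leq_trans le2 le1.
- exact: leq_trans (leq_trans le2 le1) le0.
Qed.

(* Each triple occurs in 9 of the 15 lists and each pair in 3 of the 15
   perfect matchings. *)
Definition local_triples (m : nat * nat * nat) : seq (seq nat) :=
  let p := pair_at m.1.1 in let q := pair_at m.1.2 in let r := pair_at m.2 in
  [seq sort leq s | s <-
    [:: [:: p.2; q.1; q.2]; [:: p.1; q.1; q.2]; [:: p.2; r.1; r.2]; [:: p.1; r.1; r.2];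
        [:: q.2; p.1; p.2]; [:: q.1; p.1; p.2]; [:: q.2; r.1; r.2]; [:: q.1; r.1; r.2];
        [:: r.2; p.1; p.2]; [:: r.1; p.1; p.2]; [:: r.2; q.1; q.2]; [:: r.1; q.1; q.2]]].

Definition local_sum (m : nat * nat * nat) : nat :=
  sumn [seq (t s : nat) | s <- local_triples m] +
  3 * (h (pair_at m.1.1) + h (pair_at m.1.2) + h (pair_at m.2)).

Lemma local_sum_le m : m \in perfect_matchings ->
  local_sum m < local_max l (pair_at m.1.1) (pair_at m.1.2) (pair_at m.2)
    (h (pair_at m.1.1)) (h (pair_at m.1.2)) (h (pair_at m.2)).
Proof.
rewrite mem_filter => /andP[/and3P[_ _ U] _].
rewrite /local_sum /local_triples /local_max.
move: U; set p := pair_at _; set q := pair_at _; set r := pair_at _ => U.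
have pairL i : ((pair_at i).1 < 6) /\ ((pair_at i).2 < 6).
  have [lti|gei] := ltnP i (size pairs); last by rewrite /pair_at nth_default.
  by have /and3P[] := pairs_lt (mem_nth (0, 0) lti).
have L : all (ltn^~ 6) (hexad p q r).
  have [[? ?] [? ?] [? ?]] := And3 (pairL m.1.1) (pairL m.1.2) (pairL m.2).
  by rewrite /hexad /= andbT; apply/and5P; split=> //; apply/andP.
rewrite (matching_okP U L) ltnS leq_add2r.
have tE a b c : t (sort leq [:: a; b; c]) = t [:: a; b; c].
  by apply: t_perm; rewrite perm_sort.
have key x q0 f r0 : perm_eq (x :: q0.1 :: q0.2 :: f :: r0.1 :: r0.2 :: [::]) (hexad p q r) ->
    t (sort leq [:: x; q0.1; q0.2]) <= edge_ok l x (h q0) f (h r0) r0.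
  move=> P; rewrite tE; case T : (t _) => //.
  by rewrite edge_okP // ?(perm_uniq P) ?(perm_all _ P).
(* [local_triples] follows the order of the terms of [local_max], so the two sums are compared term
   by term. *)
rewrite /edges_ok /= addn0.
by rewrite -!addnA; repeat apply: leq_add; apply: key;
   apply: perm_sumnP => P /=; clear; lia.
Qed.

Definition weight : nat := count t triples + sumn [seq h p | p <- pairs].

Lemma sum_local_sum : sumn [seq local_sum m | m <- perfect_matchings] = 9 * weight.
Proof.
have sum_flatten (T : eqType) (f : T -> nat) (s : seq T) (ss : seq (seq T)) n :
    perm_eq (flatten ss) (flatten (nseq n s)) ->
    sumn [seq sumn [seq f x | x <- u] | u <- ss] = n * sumn [seq f x | x <- s].
  move=> P; have -> : sumn [seq sumn [seq f x | x <- u] | u <- ss] = sumn [seq f x | x <- flatten ss].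
    by elim: (ss) => //= u us ->; rewrite map_cat sumn_cat.
  rewrite (perm_sumn (perm_map f P)).
  by elim: (n) => //= k; rewrite map_cat sumn_cat => ->; rewrite mulSn.
have P1 : perm_eq (flatten [seq local_triples m | m <- perfect_matchings])
    (flatten (nseq 9 triples)) by vm_compute.
have P2 : perm_eq (flatten [seq [:: pair_at m.1.1; pair_at m.1.2; pair_at m.2]
    | m <- perfect_matchings]) (flatten (nseq 3 pairs)) by vm_compute.
have -> : sumn [seq local_sum m | m <- perfect_matchings] =
    sumn [seq sumn [seq (t s : nat) | s <- u] | u <- [seq local_triples m | m <- perfect_matchings]] +
    3 * sumn [seq sumn [seq h p | p <- u] | u <- [seq [:: pair_at m.1.1; pair_at m.1.2; pair_at m.2]
                                              | m <- perfect_matchings]].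
  rewrite -!map_comp -(sumn_linear _ _ 3); congr sumn; apply: eq_map => m.
  by rewrite /local_sum; congr (_ + 3 * _); rewrite /= addn0 addnA.
rewrite (sum_flatten _ _ _ _ _ P1) (sum_flatten _ _ _ _ _ P2).
by rewrite /weight -sumn_count mulnDr mulnA.
Qed.

Lemma triple_okP s : s \in triples -> t s -> triple_ok l h s.
Proof.
have : all (fun s => all (fun u => all (fun v =>
    [&& uniq (u.1 :: u.2.1 :: u.2.2 :: v.1 :: v.2.1 :: v.2.2 :: [::]),
        all (ltn^~ 6) (u.1 :: u.2.1 :: u.2.2 :: v.1 :: v.2.1 :: v.2.2 :: [::])
      & perm_eq s [:: u.1; u.2.1; u.2.2]])
    (splits (complement s))) (splits s)) triples by vm_compute.
move=> /allP A /A{}A ts; apply/allP=> u /(allP A){}A; apply/allP=> v /(allP A)/and3P[U L P].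
by apply: edge_okP; rewrite -?(t_perm P).
Qed.

Lemma search_step tabs target todo hs :
  let vals := [seq lookup mt.2 (nth 0 hs mt.1.1.1) (nth 0 hs mt.1.1.2) (nth 0 hs mt.1.2)
              | mt <- tabs] in
  search l tabs target todo hs ->
  [\/ 0 \in vals, sumn vals <= 9 * target + 23
   | if todo is p :: todo' then
       forall v, v <= cap l p -> search l tabs target todo' (rcons hs v.+1)
     else let h p := (nth 0 hs (index p pairs)).-1 in
       sumn [seq h p | p <- pairs] + count (triple_ok l h) triples <= target].
Proof.
case: todo => [|p todo] vals /=; rewrite -/vals; case: ifP => [/orP[]|_];
  try by [constructor 1 | constructor 2].
  by constructor 3.
move=> A; constructor 3 => v le_v.
have /allP := A : all (fun v => search l tabs target todo (rcons hs v)) (iota 1 (cap l p).+1).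
apply.
by rewrite mem_iota add1n !ltnS.
Qed.

Lemma vals_gt done todo : pairs = done ++ todo ->
  all (fun m => local_sum m < lookup (table l m)
     (nth 0 [seq (h p).+1 | p <- done] m.1.1)
     (nth 0 [seq (h p).+1 | p <- done] m.1.2)
     (nth 0 [seq (h p).+1 | p <- done] m.2)) perfect_matchings.
Proof.
move=> def_pairs; apply/allP=> m Pm; apply: leq_trans (local_sum_le Pm) _.
have sz : size done <= 15 by rewrite -[15]/(size pairs) def_pairs size_cat leq_addr.
have [lt12 lt23 lt3] : [/\ m.1.1 < m.1.2, m.1.2 < m.2 & m.2 < 15].
  move: Pm; rewrite mem_filter => /andP[/and3P[-> ->] _] /allpairsP[[ij k] [_ Pk ->]].
  by move: Pk; rewrite mem_iota.
have le_cap i : i < 15 -> h (pair_at i) <= cap l (pair_at i).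
  by move=> lti; apply/h_le_cap/mem_nth.
have hsE i : i < 15 -> nth 0 [seq (h p).+1 | p <- done] i =
    if i < size done then (h (pair_at i)).+1 else 0.
  move=> lti; case: ltnP => [lt|ge]; last by rewrite nth_default ?size_map.
  by rewrite (nth_map (0, 0)) // /pair_at def_pairs nth_cat lt.
have lt2 := ltn_trans lt23 lt3; have lt1 := ltn_trans lt12 lt2.
apply: lookup_ge; rewrite ?le_cap ?hsE //.
case: (ltnP m.1.1) => [l1|g1]; last first.
  rewrite !ltnNge (leq_trans g1) 1?(leq_trans g1) ?(ltnW lt12) //=; first by constructor 4.
  exact: ltnW (ltn_trans lt12 lt23).
case: (ltnP m.1.2) => [l2|g2]; last first.
  by rewrite ltnNge (leq_trans g2) ?(ltnW lt23) //=; constructor 3.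
by case: (ltnP m.2) => [l3|g3]; [constructor 1 | constructor 2].
Qed.

Lemma sumn_lt (T : eqType) (f g : T -> nat) (s : seq T) : all (fun x => f x < g x) s ->
  0 \notin [seq g x | x <- s] /\ sumn [seq f x | x <- s] + size s <= sumn [seq g x | x <- s].
Proof.
elim: s => //= x s IH /andP[lt_fg /IH[n0 le_s]]; rewrite inE negb_or n0 andbT.
by split; lia.
Qed.

(** Along the branch where the assigned values are those of [h], no entry of the list of maxima is
    0, and the entries sum to at least 9 * [weight] + 15. Pruning by the bound 9 * [target] + 23
    therefore gives [weight] <= [target]. *)
Lemma search_sound target done todo : pairs = done ++ todo ->
  search l [seq (m, table l m) | m <- perfect_matchings] target todo
    [seq (h p).+1 | p <- done] -> weight <= target.
Proof.
elim: todo done => [|p todo IH] done def_pairs /search_step; rewrite -map_comp.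
all: have [n0 le_vals] := sumn_lt (vals_gt def_pairs).
all: rewrite sum_local_sum in le_vals.
all: have sz : size perfect_matchings = 15 by vm_compute.
all: rewrite sz in le_vals.
all: case=> [/(negP n0)//|le_t|].
1,3: by apply: contraTT le_t; rewrite -!ltnNge => lt_t; apply: leq_trans le_vals; lia.
- rewrite cats0 in def_pairs; rewrite -def_pairs => le_t; apply: leq_trans le_t.
  have hE q : q \in pairs -> (nth 0 [seq (h p).+1 | p <- pairs] (index q pairs)).-1 = h q.
    by move=> Pq; rewrite (nth_map (0, 0)) ?index_mem // nth_index.
  rewrite /weight addnC (eq_in_map _ h pairs).1 //; rewrite leq_add2l.
  apply: leq_count_in => s Ps ts.
  have := triple_okP Ps ts; congr is_true; apply: eq_in_all => u Pu; apply: eq_in_all => v Pv.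
  have : all (fun s => all (fun u => u.2 \in pairs) (splits s ++ splits (complement s))) triples.
    by vm_compute.
  move=> /allP/(_ s Ps)/allP P2.
  by rewrite !hE // P2 // mem_cat ?Pu ?Pv ?orbT.
move=> /(_ (h p)) A; apply: (IH (rcons done p)); first by rewrite cat_rcons.
by rewrite map_rcons; apply/A/h_le_cap; rewrite def_pairs mem_cat mem_head orbT.
Qed.
End Soundness.

(** * Levels of link sizes *)

Definition level (n : nat) : nat :=
  if n <= 1 then n else if n <= 3 then 2 else if n <= 6 then 3 else 4.

Lemma level_ge n k : k <= 4 -> (k <= level n) = (nth 0 [:: 0; 1; 2; 4; 7] k <= n).
Proof.
rewrite /level; case: k => [|[|[|[|[|k]]]]] //= _; do ![case: ifP]; lia.
Qed.

(** If the second link has at least two sets, the first has at most 4, so that level 3 means exactly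
    4; larger sizes occur only beside links of at most one set. As sizes are at most 9, this is a
    finite check. *)
Lemma side_levels (g0 g1 g2 : nat) : g1 <= g0 -> g2 <= g1 -> g0 <= 9 ->
    (0 < g1 -> g0 <= 6) -> (1 < g1 -> g0 <= 4) ->
  (level g0, level g1, level g2) \in sides /\
  g0 + g1 + g2 <= side_bound (level g0) (level g1) (level g2).
Proof.
have C : all (fun a => all (fun b => all (fun c =>
    [&& b <= a, c <= b, (0 < b) ==> (a <= 6) & (1 < b) ==> (a <= 4)] ==>
    ((level a, level b, level c) \in sides) &&
    (a + b + c <= side_bound (level a) (level b) (level c)))
  (iota 0 10)) (iota 0 10)) (iota 0 10) by vm_compute.
move=> le1 le2 le0 h1 h2; apply/andP.
move: C => /allP/(_ g0); rewrite mem_iota ltnS le0 => /(_ isT).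
move=> /allP/(_ g1); rewrite mem_iota ltnS (leq_trans le1) // => /(_ isT).
move=> /allP/(_ g2); rewrite mem_iota ltnS (leq_trans le2) ?(leq_trans le1) // => /(_ isT).
by move/implyP; apply; apply/and4P; split=> //; apply/implyP.
Qed.

Lemma check_search x y : let ls := [:: x.1.1; x.1.2; x.2; y.1.1; y.1.2; y.2] in
  (4 \in ls -> 2 < count (fun i => 0 < i) ls) -> check x y ->
  search (nth 0 ls) [seq (m, table (nth 0 ls) m) | m <- perfect_matchings]
    (56 - side_bound x.1.1 x.1.2 x.2 - side_bound y.1.1 y.1.2 y.2) pairs [::].
Proof.
move=> ls gt2; rewrite /check -/ls; case: ifP => // /andP[/gt2].
by rewrite ltnNge => /negPf->.
Qed.

(** Since 28 is half of 56, the truncated subtraction in the target of [check] is exact. *)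
Lemma side_bound_le x : x \in sides -> side_bound x.1.1 x.1.2 x.2 <= 28.
Proof.
have : all (fun x => side_bound x.1.1 x.1.2 x.2 <= 28) sides by vm_compute.
by move=> /allP; apply.
Qed.

(** * Links and outer neighbourhoods *)

Lemma pick_notin (V : finType) (X : {set V}) (s : seq V) :
  size s < #|X| -> exists2 x, x \in X & x \notin s.
Proof.
move=> lt_s; case: (pickP [pred x in X | x \notin s]) => [x /andP[]|none]; first by exists x.
suff /subset_leq_card : X \subset s.
  by rewrite leqNgt (leq_ltn_trans (card_size s) lt_s).
by apply/subsetP=> x Xx; have := none x; rewrite /= Xx /= => /negbFE.
Qed.

(** For more than three points covered by the parts outside U of two edges, of at most two points
    each: both parts have two points and nothing else is covered. *)
Lemma two_two m p c d : m <= p -> p <= c + d -> c <= 2 -> d <= 2 -> 3 < m ->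
  [/\ p <= m, 1 < c & 1 < d].
Proof. by move=> *; split; lia. Qed.

Section Triple.
Variables (V : finType) (F : {set {set V}}).
Hypothesis F_card : forall E, E \in F -> #|E| = 3.
Hypothesis F_no3 : forall C D E, C \in F -> D \in F -> E \in F ->
  [disjoint C & D] -> [disjoint C & E] -> [disjoint D & E] -> False.
Hypothesis F_res : forall T : {set V}, #|T| <= 2 -> exists C D,
  [/\ C \in F, D \in F, [disjoint C & D], [disjoint C & T] & [disjoint D & T]].

Lemma disjoint_notin (C D : {set V}) : (forall z, z \in C -> z \notin D) -> [disjoint C & D].
Proof. by move=> CD; rewrite disjoints_subset; apply/subsetP=> z /CD; rewrite inE. Qed.

(** The common form of the contradictions with nine explicit vertices: distinctness is proved for a
    convenient ordering [s], the rearrangement by [perm_sumnP]. *)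
Lemma no3_uniq s x1 x2 x3 x4 x5 x6 x7 x8 x9 :
  uniq s -> perm_eq s [:: x1; x2; x3; x4; x5; x6; x7; x8; x9] ->
  [set x1; x2; x3] \in F -> [set x4; x5; x6] \in F -> [set x7; x8; x9] \in F -> False.
Proof.
move=> Us P; rewrite (perm_uniq P) in Us.
have E3 a b c : [set a; b; c] = [set z in [:: a; b; c]] by apply/setP=> z; rewrite !inE orbA.
have D (s1 s2 : seq V) : uniq (s1 ++ s2) -> [disjoint [set z in s1] & [set z in s2]].
  rewrite cat_uniq => /and3P[_ /hasPn N _]; apply: disjoint_notin => z; rewrite !inE => z1.
  by apply/negP=> /N; rewrite z1.
rewrite !E3 => F1 F2 F3.
have U12 : uniq ([:: x1; x2; x3] ++ [:: x4; x5; x6]).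
  by apply: subseq_uniq Us; apply: (prefix_subseq _ [:: x7; x8; x9]).
have U23 : uniq ([:: x4; x5; x6] ++ [:: x7; x8; x9]).
  by apply: subseq_uniq Us; apply: (suffix_subseq [:: x1; x2; x3]).
have U13 : uniq ([:: x1; x2; x3] ++ [:: x7; x8; x9]).
  apply: subseq_uniq Us; apply: (@cat_subseq _ [:: x1; x2; x3] _ [:: x1; x2; x3]) => //.
  exact: (suffix_subseq [:: x4; x5; x6]).
exact: F_no3 F1 F2 F3 (D _ _ U12) (D _ _ U13) (D _ _ U23).
Qed.

Section Base.
Variables A B : {set V}.
Hypotheses (FA : A \in F) (FB : B \in F) (AB : [disjoint A & B]).
Let U := A :|: B.

Definition outer (a b : V) : {set V} := [set w | (w \notin U) && ([set a; b; w] \in F)].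
Definition link (a : V) : {set {set V}} :=
  [set e : {set V} | [&& #|e| == 2, [disjoint e & U] & a |: e \in F]].

Lemma outerP a b w : w \in outer a b -> w \notin U /\ [set a; b; w] \in F.
Proof. by rewrite inE => /andP. Qed.

Lemma linkP a e : e \in link a -> exists x y,
  [/\ e = [set x; y], x != y, x \notin U, y \notin U & [set a; x; y] \in F].
Proof.
rewrite inE => /and3P[/cards2P[x [y [nxy ->]]] dU Fe]; exists x, y.
by rewrite -setUA !(disjointFr dU) // !inE eqxx ?orbT.
Qed.

Lemma uniq_catU us ws : uniq us -> {subset us <= U} -> uniq ws -> all [predC U] ws ->
  uniq (us ++ ws).
Proof.
move=> Uus sU Uws /allP nU; rewrite cat_uniq Uus Uws andbT /=.
by apply/hasPn=> w /nU /=; apply: contra => /sU.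
Qed.

(** Distinct third points are chosen greedily, starting with the pair that is only known to have
    one. *)
Lemma outer3 a b c d e f : uniq [:: a; b; c; d; e; f] -> {subset [:: a; b; c; d; e; f] <= U} ->
  0 < #|outer a b| -> 1 < #|outer c d| -> 2 < #|outer e f| -> False.
Proof.
move=> Us sU /(@pick_notin _ _ [::])[w1 /outerP[n1 F1] _].
move=> /(@pick_notin _ _ [:: w1])[w2 /outerP[n2 F2] d2].
move=> /(@pick_notin _ _ [:: w1; w2])[w3 /outerP[n3 F3] d3].
apply: (no3_uniq (uniq_catU Us sU (ws := [:: w3; w2; w1]) _ _) _ F1 F2 F3) => /=.
- by move: d2 d3; rewrite !inE !negb_or => -> /andP[-> ->].
- by rewrite /= n1 n2 n3.
by apply: perm_sumnP => p /=; clear; lia.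
Qed.

Lemma outer2_link a b c d e : uniq [:: a; b; c; d; e] -> {subset [:: a; b; c; d; e] <= U} ->
  0 < #|link e| -> 2 < #|outer a b| -> 3 < #|outer c d| -> False.
Proof.
move=> Us sU /card_gt0P[g /linkP[x [y [_ nxy nx ny F3]]]].
move=> /(@pick_notin _ _ [:: x; y])[w1 /outerP[n1 F1] d1].
move=> /(@pick_notin _ _ [:: w1; x; y])[w2 /outerP[n2 F2] d2].
apply: (no3_uniq (uniq_catU Us sU (ws := [:: w2; w1; x; y]) _ _) _ F1 F2 F3) => /=.
- by rewrite d1 d2 inE nxy.
- by rewrite /= n1 n2 nx ny.
by apply: perm_sumnP => p /=; clear; lia.
Qed.

(** Otherwise abc, dew and the edge formed by f and g are disjoint. *)
Lemma outer_link_in a b c d e f : uniq [:: a; b; c; d; e; f] ->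
  {subset [:: a; b; c; d; e; f] <= U} -> [set a; b; c] \in F ->
  forall w g, w \in outer d e -> g \in link f -> w \in g.
Proof.
move=> Us sU F1 w _ /outerP[n2 F2] /linkP[x [y [-> nxy nx ny F3]]].
apply/negPn/negP => wg.
apply: (no3_uniq (uniq_catU Us sU (ws := [:: w; x; y]) _ _) _ F1 F2 F3) => /=.
- by move: wg; rewrite !inE negb_or nxy andbT => /andP[/negPf-> /negPf->].
- by rewrite /= n2 nx ny.
by apply: perm_sumnP => p /=; clear; lia.
Qed.

(** Otherwise abc and the edges formed by d with g and by f with g' are disjoint. *)
Lemma links_meet a b c d f : uniq [:: a; b; c; d; f] ->
  {subset [:: a; b; c; d; f] <= U} -> [set a; b; c] \in F ->
  forall g g', g \in link d -> g' \in link f -> ~~ [disjoint g & g'].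
Proof.
move=> Us sU F1 _ _ /linkP[x [y [-> nxy nx ny F2]]] /linkP[z [u [-> nzu nz nu F3]]].
apply/negP=> D.
apply: (no3_uniq (uniq_catU Us sU (ws := [:: x; y; z; u]) _ _) _ F1 F2 F3) => /=.
- have zg : z \notin [set x; y] by rewrite (disjointFl D) // !inE eqxx.
  have ug : u \notin [set x; y] by rewrite (disjointFl D) // !inE eqxx orbT.
  move: zg ug; rewrite !inE !negb_or nxy nzu /= andbT => /andP[zx zy] /andP[ux uy].
  by rewrite ![x == _]eq_sym ![y == _]eq_sym zx zy ux uy.
- by rewrite /= nx ny nz nu.
by apply: perm_sumnP => p /=; clear; lia.
Qed.

Lemma meetsU C : C \in F -> exists2 c, c \in U & c \in C.
Proof.
move=> FC; case: (pickP [pred c in U | c \in C]) => [c /andP[]|none]; first by exists c.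
have N z : z \in U -> z \notin C by move=> Uz; have := none z; rewrite /= Uz /= => ->.
by case: (F_no3 FA FB FC AB); apply: disjoint_notin => z zA; apply: N; rewrite inE zA ?orbT.
Qed.

Lemma card_outside C : C \in F -> #|C :\: U| <= 2.
Proof.
move=> FC; have [c Uc Cc] := meetsU FC.
have := cardsID U C; rewrite (F_card FC) => E.
suff : 0 < #|C :&: U| by lia.
by apply/card_gt0P; exists c; rewrite inE Cc.
Qed.

Lemma trace1 C : C \in F -> 1 < #|C :\: U| ->
  exists c, [/\ c \in U, C :&: U = [set c] & C :\: U \in link c].
Proof.
move=> FC gt1; have e2 : #|C :\: U| = 2 by apply/eqP; rewrite eqn_leq card_outside.
have := cardsID U C; rewrite (F_card FC) e2 => E.
have /eqP/cards1P[c Ec] : #|C :&: U| = 1 by lia.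
exists c; have : c \in C :&: U by rewrite Ec set11.
rewrite inE => /andP[_ Uc]; split=> //; rewrite inE e2 eqxx -Ec setID FC andbT /=.
by apply: disjoint_notin => z; rewrite inE => /andP[].
Qed.

Lemma avoid_union C D (E : {set V}) : C \in F -> D \in F -> [disjoint C & D] -> E \in F ->
  exists2 z, z \in E & (z \in C) || (z \in D).
Proof.
move=> FC FD CD FE; case: (pickP [pred z in E | (z \in C) || (z \in D)]) => [z /andP[]|none].
  by exists z.
by case: (F_no3 FC FD FE CD); apply: disjoint_notin => z zC; apply/negP=> zE;
   have := none z; rewrite /= zE zC ?orbT.
Qed.

(* Were there four such x, the two disjoint edges C, D avoiding a and w would
   consist of these x and of one point of U each.  One of these points, say
   that in C, is on the same side A or B as a, since otherwise C, D and that side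
   are disjoint; then C, the other side and {a, w, x} with x in D are disjoint. *)
Lemma star_le3 a w : a \in U -> w \notin U ->
  #|[set x | (x \notin U) && ([set a; w; x] \in F)]| <= 3.
Proof.
move=> Ua nw; set X := [set x | _]; rewrite leqNgt; apply/negP=> gt3.
have [|C [D [FC FD CD]]] := F_res (T := [set a; w]); first by rewrite cards2; case: eqP.
move=> CT DT.
have sX : X \subset (C :\: U) :|: (D :\: U).
  apply/subsetP=> x; rewrite inE => /andP[nx Fx].
  rewrite in_setU !in_setD nx; have [z] := avoid_union FC FD CD Fx.
  rewrite !inE -orbA => /or3P[/eqP->|/eqP->|/eqP->] //.
    by rewrite !(disjointFl _ (set21 a w)).
  by rewrite !(disjointFl _ (set22 a w)).
have [cC cD] := (card_outside FC, card_outside FD).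
have cU := leq_card_setU (C :\: U) (D :\: U).
have cX := subset_leq_card sX.
have [geX gC gD] := two_two cX cU cC cD gt3.
have eX : X = (C :\: U) :|: (D :\: U) by apply/eqP; rewrite eqEcard sX.
have [c [Uc Ec _]] := trace1 FC gC; have [d [Ud Ed _]] := trace1 FD gD.
have aux (A' B' : {set V}) : A' \in F -> B' \in F -> [disjoint A' & B'] ->
    A' :|: B' = U -> a \in A' -> False.
  move=> FA' FB' AB' EU aA'.
  have sub z : z \in U = (z \in A') || (z \in B') by rewrite -EU inE.
  have aux2 (C' D' : {set V}) c' : C' \in F -> [disjoint C' & D'] -> [disjoint C' & [set a; w]] ->
      C' :&: U = [set c'] -> 1 < #|D' :\: U| -> D' :\: U \subset X -> c' \in A' -> False.
    move=> FC' CD' CT' Ec' gD' sD' c'A.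
    have /card_gt0P[x Dx] : 0 < #|D' :\: U| by exact: ltnW.
    have := subsetP sD' _ Dx; rewrite inE => /andP[nx Fx].
    move: Dx; rewrite inE nx => Dx.
    apply: (F_no3 Fx FC' FB'); apply: disjoint_notin => z.
    - rewrite !inE -orbA => /or3P[]/eqP->.
      + by rewrite (disjointFl CT') // set21.
      + by rewrite (disjointFl CT') // set22.
      by rewrite (disjointFl CD').
    - rewrite !inE -orbA => /or3P[]/eqP->.
      + by rewrite (disjointFr AB').
      + by apply: contra nw; rewrite sub orbC => ->.
      by apply: contra nx; rewrite sub orbC => ->.
    move=> zC; apply/negP=> zB.
    have : z \in C' :&: U by rewrite inE zC sub zB orbT.
    by rewrite Ec' inE => /eqP zc; rewrite zc (disjointFr AB') in zB.
  have [cA|ncA] := boolP (c \in A').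
    by apply: (aux2 C D c) => //; rewrite eX subsetUr.
  have [dA|ndA] := boolP (d \in A').
    by apply: (aux2 D C d) => //; rewrite 1?disjoint_sym // eX subsetUl.
  have notin (E : {set V}) e : E :&: U = [set e] -> e \notin A' -> [disjoint E & A'].
    move=> Ee neA; apply: disjoint_notin => z zE; apply/negP=> zA.
    have : z \in E :&: U by rewrite inE zE sub zA.
    by rewrite Ee inE => /eqP ze; rewrite -ze zA in neA.
  exact: (F_no3 FC FD FA' CD (notin _ _ Ec ncA) (notin _ _ Ed ndA)).
have BA : [disjoint B & A] by rewrite disjoint_sym.
by move: Ua; rewrite inE => /orP[/(aux A B FA FB AB erefl)|/(aux B A FB FA BA (setUC B A))].
Qed.

Lemma degree_le3 a w : a \in U -> w \notin U -> #|[set g in link a | w \in g]| <= 3.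
Proof.
move=> Ua nw; apply: leq_trans (star_le3 Ua nw).
apply: leq_trans (leq_imset_card (fun x => [set w; x]) _).
apply/subset_leq_card/subsetP=> g; rewrite inE => /andP[/linkP[x [y [-> nxy nx ny Fxy]]]].
rewrite !inE => /orP[]/eqP->.
  by apply/imsetP; exists y; rewrite // inE ny Fxy.
by apply/imsetP; exists x; [rewrite inE nx setUAC | rewrite setUC].
Qed.

(** Two disjoint edges C, D avoiding a and b meet every edge through a and b, so they contain its
    third point; together they have at most four points outside U. If all four are used, C and D
    meet U in single points with nonempty links, and x is one of these. *)
Lemma outer_le4 a b : a \in U -> b \in U -> #|outer a b| <= 4 /\
  (#|outer a b| = 4 -> forall x, x \in U -> x != a -> x != b -> [set a; b; x] \in F ->
   0 < #|link x|).
Proof.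
move=> Ua Ub.
have [|C [D [FC FD CD CT DT]]] := F_res (T := [set a; b]); first by rewrite cards2; case: eqP.
have hit x : [set a; b; x] \in F -> (x \in C) || (x \in D).
  move=> Fx; have [z] := avoid_union FC FD CD Fx.
  rewrite !inE -orbA => /or3P[/eqP->|/eqP->|/eqP->] //.
    by rewrite !(disjointFl _ (set21 a b)).
  by rewrite !(disjointFl _ (set22 a b)).
have sN : outer a b \subset (C :\: U) :|: (D :\: U).
  by apply/subsetP=> x /outerP[nx /hit]; rewrite in_setU !in_setD nx.
have [cC cD] := (card_outside FC, card_outside FD).
have cU := leq_card_setU (C :\: U) (D :\: U).
have cX := subset_leq_card sN.
split; first exact: leq_trans cX (leq_trans cU (leq_add cC cD)).
move=> e4 x Ux nxa nxb /hit.
have [_ gC gD] := two_two cX cU cC cD (eq_leq (esym e4)).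
have [c [Uc Ec Lc]] := trace1 FC gC; have [d [Ud Ed Ld]] := trace1 FD gD.
case/orP=> xE; apply/card_gt0P.
  have : x \in C :&: U by rewrite in_setI xE.
  by rewrite Ec inE => /eqP->; exists (C :\: U).
have : x \in D :&: U by rewrite in_setI xE.
by rewrite Ed inE => /eqP->; exists (D :\: U).
Qed.

(** Each point of the cover W lies in at most three sets of the link. *)
Lemma link_cover a (W : {set V}) : a \in U -> [disjoint W & U] ->
  (forall g, g \in link a -> ~~ [disjoint g & W]) -> #|link a| <= 3 * #|W|.
Proof.
move=> Ua WU cov.
have : link a \subset \bigcup_(w in W) [set g in link a | w \in g].
  apply/subsetP=> g Lg; have := cov g Lg; rewrite -setI_eq0 => /set0Pn[w].
  by rewrite inE => /andP[wg wW]; apply/bigcupP; exists w => //; rewrite inE Lg.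
move=> /subset_leq_card/leq_trans; apply.
apply: leq_trans (_ : \sum_(w in W) 3 <= _); last by rewrite sum_nat_const mulnC.
have le_big : #|\bigcup_(w in W) [set g in link a | w \in g]| <=
    \sum_(w in W) #|[set g in link a | w \in g]|.
  elim/big_rec2: _ => [|w m X _ leX]; first by rewrite cards0.
  by apply: leq_trans (leq_card_setU _ _) _; rewrite leq_add2l.
apply: leq_trans le_big _; apply: leq_sum => w wW; apply: degree_le3 => //.
by rewrite (disjointFr WU).
Qed.

Lemma link_card a g : g \in link a -> #|g| = 2.
Proof. by rewrite inE => /and3P[/eqP]. Qed.

Lemma link_disjointU a g : g \in link a -> [disjoint g & U].
Proof. by rewrite inE => /and3P[]. Qed.

(** * Links opposite an edge inside U *)

Section Opposite.
Variables a b c d f : V.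
Hypothesis Us : uniq [:: a; b; c; d; f].
Hypothesis sU : {subset [:: a; b; c; d; f] <= U}.
Hypothesis Fabc : [set a; b; c] \in F.

Let Uf : f \in U. Proof. by apply: sU; rewrite !inE eqxx !orbT. Qed.

(** The two points of any set of [link d] cover [link f]. *)
Lemma link_le6 : 0 < #|link d| -> #|link f| <= 6.
Proof.
move=> /card_gt0P[g Lg]; rewrite -[6]/(3 * 2).
rewrite -[X in _ * X](link_card Lg); apply: link_cover => // [|g' Lg']; first exact: link_disjointU Lg.
by rewrite disjoint_sym; apply: links_meet Us sU Fabc _ _ Lg Lg'.
Qed.

(** If [link d] has two disjoint sets, those of [link f] are among their four transversals. If it
    has two sets wx and wy, each set of [link f] contains w, which holds for at most three, or is
    xy. *)
Lemma link_le4 : 1 < #|link d| -> #|link f| <= 4.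
Proof.
move=> /card_gt1P[g1 [g2 [Lg1 Lg2 ng]]].
have meet g g' := @links_meet a b c d f Us sU Fabc g g'.
have [D|] := boolP [disjoint g1 & g2].
  have [x [y [E1 nxy _ _ _]]] := linkP Lg1; have [z [u [E2 nzu _ _ _]]] := linkP Lg2.
  have : link f \subset [set [set x; z]; [set x; u]; [set y; z]; [set y; u]].
    apply/subsetP=> g Lg; have := meet _ _ Lg1 Lg; have := meet _ _ Lg2 Lg.
    rewrite -!setI_eq0 => /set0Pn[p /setIP[p2 pg]] /set0Pn[q /setIP[q1 qg]].
    have npq : q != p by apply: contraTneq p2 => <-; rewrite (disjointFr D).
    have -> : g = [set q; p].
      by apply/esym/eqP; rewrite eqEcard (link_card Lg) cards2 npq andbT subUset !sub1set qg.
    move: p2 q1; rewrite E1 E2 !inE => /orP[]/eqP-> /orP[]/eqP->; rewrite eqxx ?orbT //.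
  move/subset_leq_card/leq_trans; apply.
  by rewrite -!setUA !cardsU1 cards1; do ![case: (_ \notin _)].
rewrite -setI_eq0 => /set0Pn[w /setIP[w1 w2]].
have other g : g \in link d -> w \in g -> exists2 x, x != w & g = [set w; x].
  move=> /linkP[x [y [-> nxy _ _ _]]]; rewrite !inE => /orP[]/eqP->.
    by exists y; rewrite // eq_sym.
  by exists x; rewrite // setUC.
have [x nx E1] := other _ Lg1 w1; have [y ny E2] := other _ Lg2 w2.
have nxy : x != y by apply: contraNneq ng => exy; rewrite E1 E2 exy.
have nw : w \notin U by rewrite (disjointFr (link_disjointU Lg1)).
have : link f \subset [set g in link f | w \in g] :|: [set [set x; y]].
  apply/subsetP=> g Lg; rewrite !inE -[_ && _](andbb (_ && _)); have := Lg; rewrite inE => -> /=.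
  rewrite andbb; case: (boolP (w \in g)) => //= nwg.
  have xg : x \in g.
    have := meet _ _ Lg1 Lg; rewrite -setI_eq0 => /set0Pn[p /setIP[]].
    by rewrite E1 !inE => /orP[]/eqP-> //; rewrite (negPf nwg).
  have yg : y \in g.
    have := meet _ _ Lg2 Lg; rewrite -setI_eq0 => /set0Pn[p /setIP[]].
    by rewrite E2 !inE => /orP[]/eqP-> //; rewrite (negPf nwg).
  by rewrite eq_sym eqEcard (link_card Lg) cards2 nxy andbT subUset !sub1set xg.
move/subset_leq_card/leq_trans; apply; apply: leq_trans (leq_card_setU _ _) _.
by rewrite cards1 addn1 ltnS degree_le3.
Qed.
End Opposite.

Section OppositePair.
Variables a b c d e f : V.
Hypothesis Us : uniq [:: a; b; c; d; e; f].
Hypothesis sU : {subset [:: a; b; c; d; e; f] <= U}.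
Hypothesis Fabc : [set a; b; c] \in F.

Lemma outer_sub_link g : g \in link f -> outer d e \subset g.
Proof.
move=> Lg; apply/subsetP=> w Nw; exact: outer_link_in Us sU Fabc _ _ Nw Lg.
Qed.

Lemma outer_le2 : 0 < #|link f| -> #|outer d e| <= 2.
Proof.
move=> /card_gt0P[g Lg]; rewrite -[X in _ <= X](link_card Lg); exact/subset_leq_card/outer_sub_link.
Qed.

Lemma outer_le1 : 1 < #|link f| -> #|outer d e| <= 1.
Proof.
move=> /card_gt1P[g1 [g2 [Lg1 Lg2 /eqP ng]]]; rewrite leqNgt; apply/negP=> gt1.
have E g : g \in link f -> outer d e = g.
  by move=> Lg; apply/eqP; rewrite eqEcard outer_sub_link // (link_card Lg).
by apply: ng; rewrite -(E _ Lg1) -(E _ Lg2).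
Qed.

(** A point of [outer d e] would lie in all sets of [link f], against [degree_le3]. *)
Lemma outer_eq0 : 3 < #|link f| -> #|outer d e| = 0.
Proof.
move=> gt3; apply/eqP; rewrite cards_eq0; apply/set0Pn=> -[w Nw].
have Uf : f \in U by apply: sU; rewrite !inE eqxx !orbT.
have [nw _] := outerP Nw.
have := degree_le3 Uf nw; rewrite leqNgt => /negP; apply; apply: leq_trans gt3 _.
apply/subset_leq_card/subsetP=> g Lg; have := subsetP (outer_sub_link Lg) w Nw.
by rewrite [_ \in [set _ in _ | _]]inE Lg.
Qed.
End OppositePair.

(** Every edge meets the union of C and D, and f is not in it, so the part of this union outside U
    covers the link. *)
Lemma link_le_outside f C D : f \in U -> C \in F -> D \in F -> [disjoint C & D] ->
  f \notin C -> f \notin D -> #|link f| <= 3 * #|(C :|: D) :\: U|.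
Proof.
move=> Uf FC FD CD fC fD; apply: link_cover => // [|g Lg].
  by apply: disjoint_notin => z; rewrite inE => /andP[].
move: (Lg); rewrite inE => /and3P[_ gU Fg].
have [z] := avoid_union FC FD CD Fg; rewrite !inE => /orP[/eqP->|zg zCD].
  by rewrite (negPf fC) (negPf fD).
by rewrite -setI_eq0; apply/set0Pn; exists z; rewrite in_setI in_setD in_setU zg zCD (disjointFr gU).
Qed.

Lemma card_outsideU C D : C \in F -> D \in F ->
  #|(C :|: D) :\: U| <= #|C :\: U| + #|D :\: U|.
Proof. by move=> FC FD; rewrite setDUl; apply: leq_card_setU. Qed.

(** Take disjoint edges C, D avoiding f and b. If each had at most one point outside U, two points
    would cover [link f], leaving at most 6 sets. So one of them has two outer points, and these
    form a set in the link of its vertex in U. *)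
Lemma link_gt6 f b : f \in U -> b \in U -> 6 < #|link f| ->
  exists c, [/\ c \in U, c != f, c != b & 0 < #|link c|].
Proof.
move=> Uf Ub gt6.
have [|C [D [FC FD CD CT DT]]] := F_res (T := [set f; b]); first by rewrite cards2; case: eqP.
have [fC fD] : f \notin C /\ f \notin D by rewrite !(disjointFl _ (set21 f b)).
have le := link_le_outside Uf FC FD CD fC fD; have le' := card_outsideU FC FD.
have key E : E \in F -> [disjoint E & [set f; b]] -> 1 < #|E :\: U| ->
    exists c, [/\ c \in U, c != f, c != b & 0 < #|link c|].
  move=> FE ET /(trace1 FE)[c [Uc Ec Lc]].
  have cE : c \in E by have := set11 c; rewrite -Ec inE => /andP[].
  have := disjointFr ET cE; rewrite !inE => /negbT; rewrite negb_or => /andP[cf cb].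
  by exists c; split=> //; apply/card_gt0P; exists (E :\: U).
have [gC|dC] := ltnP 1 #|C :\: U|; first exact: (key C).
have [gD|dD] := ltnP 1 #|D :\: U|; first exact: (key D).
have := leq_trans gt6 (leq_trans le (leq_mul (leqnn 3) (leq_trans le' (leq_add dC dD)))).
by [].
Qed.

(** Disjoint edges C, D avoiding f have at most three points outside U together, and these cover
    [link f]. With four, each would meet U in one vertex with a nonempty link, hence not in E, and
    C, D, E would be disjoint. *)
Lemma link_le9 E f : E \in F -> E \subset U -> f \in E ->
  (forall c, c \in E -> c != f -> #|link c| = 0) -> #|link f| <= 9.
Proof.
move=> FE sEU fE lone; have Uf := subsetP sEU _ fE.
have [|C [D [FC FD CD CT DT]]] := F_res (T := [set f]); first by rewrite cards1.
have [fC fD] : f \notin C /\ f \notin D by rewrite !(disjointFl _ (set11 f)).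
apply: leq_trans (link_le_outside Uf FC FD CD fC fD) _.
rewrite -[9]/(3 * 3) leq_mul2l /=; apply: leq_trans (card_outsideU FC FD) _.
rewrite leqNgt; apply/negP=> gt3.
have [cC cD] := (card_outside FC, card_outside FD).
have key G : G \in F -> f \notin G -> 1 < #|G :\: U| -> [disjoint G & E].
  move=> FG fG /(trace1 FG)[c [Uc Ec Lc]]; apply: disjoint_notin => z zG; apply/negP=> zE.
  have : z \in G :&: U by rewrite inE zG (subsetP sEU).
  rewrite Ec inE => /eqP zc; rewrite zc in zE zG.
  have cf : c != f by apply: contraNneq fG => <-.
  by have := lone c zE cf; apply/eqP; rewrite -lt0n; apply/card_gt0P; exists (G :\: U).
have [_ gC gD] := two_two (leqnn _) (leqnn _) cC cD gt3.
by apply: (F_no3 FC FD FE CD); apply: key.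
Qed.
(** * The upper bound *)

Variable a0 : V.
Hypothesis a0A : a0 \in A.
Let g x := #|link x|.
(** The vertices of A and of B are numbered by decreasing link size, as in [sides]. *)
Let by_degree (E : {set V}) := sort (fun x y => g y <= g x) (enum E).
Let base := by_degree A ++ by_degree B.
(** As the default [a0] lies in A, [v i] is in U for every i. *)
Let v i := nth a0 base i.
Let t (r : seq nat) := [set x in [seq v i | i <- r]] \in F.
Let h (p : nat * nat) := #|outer (v p.1) (v p.2)|.
Let ls := [:: level (g (v 0)); level (g (v 1)); level (g (v 2));
              level (g (v 3)); level (g (v 4)); level (g (v 5))].
Let l := nth 0 ls.

Lemma size_by_degree E : E \in F -> size (by_degree E) = 3.
Proof. by move=> FE; rewrite size_sort -cardE F_card. Qed.

Lemma size_base : size base = 6.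
Proof. by rewrite size_cat !size_by_degree. Qed.

Lemma mem_base x : (x \in base) = (x \in U).
Proof. by rewrite mem_cat !mem_sort !mem_enum in_setU. Qed.

Lemma uniq_base : uniq base.
Proof.
rewrite cat_uniq !sort_uniq !enum_uniq andbT /=; apply/hasPn=> x.
by rewrite !mem_sort !mem_enum => xB; rewrite (disjointFl AB).
Qed.

Lemma vU i : v i \in U.
Proof.
have [lti|gei] := ltnP i (size base); first by rewrite -mem_base mem_nth.
by rewrite /v nth_default // in_setU a0A.
Qed.

Lemma uniq_v r : uniq r -> all (ltn^~ 6) r -> uniq [seq v i | i <- r].
Proof.
move=> Ur /allP lr; rewrite map_inj_in_uniq // => i j /lr /= li /lr /= lj /eqP.
by rewrite nth_uniq ?size_base ?uniq_base // => /eqP.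
Qed.

Lemma sub_v r : {subset [seq v i | i <- r] <= U}.
Proof. by move=> _ /mapP[i _ ->]; apply: vU. Qed.

Lemma lE i : i < 6 -> l i = level (g (v i)).
Proof. by case: i => [|[|[|[|[|[|]]]]]]. Qed.

Lemma l_ge i k : i < 6 -> k <= 4 -> (k <= l i) = (nth 0 [:: 0; 1; 2; 4; 7] k <= g (v i)).
Proof. by move=> lti le4; rewrite lE // level_ge. Qed.

Lemma t_perm r1 r2 : perm_eq r1 r2 -> t r1 = t r2.
Proof.
move=> P; rewrite /t; congr (_ \in F); apply/setP=> x; rewrite !inE.
exact/perm_mem/perm_map.
Qed.

Lemma tE i j k : t [:: i; j; k] = ([set v i; v j; v k] \in F).
Proof. by rewrite /t; congr (_ \in F); apply/setP=> x; rewrite !inE orbA. Qed.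

Lemma h_le4 p : h p <= 4.
Proof. by have [] := outer_le4 (vU p.1) (vU p.2). Qed.

Lemma leb_leq m n : m <= n -> Nat.leb m n.
Proof. by move=> le_mn; apply/PeanoNat.Nat.leb_le/leP. Qed.

Lemma is0P n : reflect (n = 0) (is0 n).
Proof. by case: n => [|n]; constructor. Qed.

Lemma is4P n : reflect (n = 4) (is4 n).
Proof. by move: n; do 5![case; first by constructor]; move=> n; constructor. Qed.

Lemma crowdedP a b c :
  (l a = 4 -> l b = 0 /\ l c = 0) -> (l b = 4 -> l a = 0 /\ l c = 0) ->
  (l c = 4 -> l a = 0 /\ l b = 0) -> ~~ crowded l a b c.
Proof.
rewrite /crowded => Ha Hb Hc.
case: is4P => [/Ha[-> ->]//|_]; case: is4P => [/Hb[-> ->]//|_].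
by case: is4P => [/Hc[-> ->]//|_].
Qed.

Lemma edge_okP (x : nat) (q : nat * nat) (f : nat) (r : nat * nat) :
  uniq (x :: q.1 :: q.2 :: f :: r.1 :: r.2 :: [::]) ->
  all (ltn^~ 6) (x :: q.1 :: q.2 :: f :: r.1 :: r.2 :: [::]) ->
  t [:: x; q.1; q.2] -> edge_ok l x (h q) f (h r) r.
Proof.
case: q r => [a b] [d e] /= Us Ls; rewrite tE => Fxab.
have /and5P[lx la lb lf /and3P[ld le _]] := Ls.
have Uv (s : seq nat) : perm_eq s [:: x; a; b; f; d; e] -> uniq [seq v i | i <- s].
  by move=> P; apply: uniq_v; rewrite ?(perm_uniq P) // (perm_all _ P).
(* The edge xab makes the links of i and j cross-intersecting, so more than 6 sets in one leave none
   in the other; k only completes the permutation. *)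
have light i j k : i < 6 -> j < 6 ->
    perm_eq [:: x; a; b; j; i; k] [:: x; a; b; f; d; e] -> l i = 4 -> l j = 0.
  move=> li lj P l4; have : 6 < g (v i) by rewrite -(@l_ge i 4) ?l4.
  case: (posnP (l j)) => //; rewrite (@l_ge j 1) //= => gj.
  have Us5 : uniq [seq v i | i <- [:: x; a; b; j; i]].
    exact: subseq_uniq (prefix_subseq [:: v x; v a; v b; v j; v i] [:: v k]) (Uv _ P).
  by rewrite ltnNge (link_le6 Us5 (@sub_v [:: x; a; b; j; i]) Fxab gj).
have light' i j k : i < 6 -> j < 6 -> k < 6 ->
    perm_eq [:: i; j; k] [:: f; d; e] -> l i = 4 -> l j = 0 /\ l k = 0.
  move=> li lj lk P l4; split; [apply: (light i j k) | apply: (light i k j)] => //.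
    rewrite !perm_cons; apply: perm_trans P; apply: perm_sumnP => p /=; clear; lia.
  rewrite !perm_cons; apply: perm_trans P; apply: perm_sumnP => p /=; clear; lia.
have ncr : ~~ crowded l f d e.
  by apply: crowdedP; apply: light' => //; apply: perm_sumnP => p /=; clear; lia.
rewrite /edge_ok leb_leq; last first.
  have U1 : uniq [seq v i | i <- [:: x; a; b; d; e; f]].
    by apply: Uv; apply: perm_sumnP => p /=; clear; lia.
  have := outer_le2 U1 (@sub_v [:: x; a; b; d; e; f]) Fxab.
  have := outer_le1 U1 (@sub_v [:: x; a; b; d; e; f]) Fxab.
  have := outer_eq0 U1 (@sub_v [:: x; a; b; d; e; f]) Fxab.
  have := h_le4 (d, e); rewrite lE // /h /=.
  rewrite -/(g (v f)) /level; case: (g (v f)) => [|[|[|[|n]]]] //=.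
  - by move=> _ _ _ /(_ isT).
  - by move=> _ _ /(_ isT).
  - by move=> _ _ /(_ isT).
  by move=> _ /(_ isT)->.
(* It remains to exclude four outer points for the pair ab when the link of x is empty. *)
case: is4P => [h4|//]; case: is0P => // lx0.
have Uq : uniq [seq v i | i <- [:: x; a; b]].
  exact: subseq_uniq (prefix_subseq [:: v x; v a; v b] [:: v f; v d; v e]) (Uv _ (perm_refl _)).
move: Uq; rewrite /= !inE negb_or => /andP[/andP[xa xb] _].
have [_ /(_ h4 (v x) (vU x) xa xb)] := outer_le4 (vU a) (vU b).
have -> : [set v a; v b; v x] = [set v x; v a; v b].
  by apply/setP=> y; rewrite !inE orbC orbA.
by move=> /(_ Fxab); rewrite -/(g (v x)) -[1]/(nth 0 [:: 0; 1; 2; 4; 7] 1) -l_ge // lx0.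
Qed.

Lemma matching_okP p q r : uniq (hexad p q r) -> all (ltn^~ 6) (hexad p q r) ->
  matching_ok l p q r (h p) (h q) (h r).
Proof.
move=> Us Ls.
have Uv (s : seq nat) : perm_eq s (hexad p q r) -> uniq [seq v i | i <- s].
  by move=> P; apply: uniq_v; rewrite ?(perm_uniq P) // (perm_all _ P).
have no_rainbow p' q' r' : perm_eq (hexad p' q' r') (hexad p q r) ->
    rainbow (h p') (h q') (h r') = false.
  move=> P; apply/negP => R; have Us' := Uv _ P.
  have [g1 g2 g3] : [/\ 0 < h p', 1 < h q' & 2 < h r'].
    by move: R; case: (h p') (h q') (h r') => [|?] [|[|?]] [|[|[|?]]].
  exact: (outer3 Us' (@sub_v (hexad p' q' r')) g1 g2 g3).
have no_large p' q' r' : perm_eq (hexad p' q' r') (hexad p q r) ->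
    large l (h p') (h q') r' = false.
  move=> P; apply/negP => R; have Us' := Uv _ P.
  have key a b x (y : nat) : perm_eq (hexad a b (x, y)) (hexad p q r) ->
      0 < l x -> 2 < h a -> 3 < h b -> False.
    move=> P' lx g1 g2.
    have xl : x < 6 by have := perm_all (ltn^~ 6) P'; rewrite Ls => /and5P[_ _ _ _ /andP[]].
    rewrite (@l_ge x 1) // in lx.
    have Us5 : uniq [seq v i | i <- [:: a.1; a.2; b.1; b.2; x]].
      exact: subseq_uniq (prefix_subseq [:: v a.1; v a.2; v b.1; v b.2; v x] [:: v y]) (Uv _ P').
    exact: (outer2_link Us5 (@sub_v [:: a.1; a.2; b.1; b.2; x]) lx g1 g2).
  have P2 : perm_eq (hexad p' q' (r'.2, r'.1)) (hexad p q r).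
    by apply: perm_trans P; apply: perm_sumnP => k /=; clear; lia.
  have P3 : perm_eq (hexad q' p' r') (hexad p q r).
    by apply: perm_trans P; apply: perm_sumnP => k /=; clear; lia.
  have P4 : perm_eq (hexad q' p' (r'.2, r'.1)) (hexad p q r).
    by apply: perm_trans P3; apply: perm_sumnP => k /=; clear; lia.
  have [lr gt] : (0 < l r'.1) || (0 < l r'.2) /\
      (2 < h p') && (3 < h q') || (2 < h q') && (3 < h p').
    move: R; rewrite /large.
    case: (h p') (h q') => [|[|[|x]]] [|[|[|y]]] //.
    by case: x y => [|x] [|y] //; case: (l r'.1) (l r'.2) => [|?] [|?].
  case/orP: gt => /andP[g1 g2]; case/orP: lr => lr.
  - exact: (key p' q' r'.1 r'.2 P).
  - exact: (key p' q' r'.2 r'.1 P2).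
  - exact: (key q' p' r'.1 r'.2 P3).
  - exact: (key q' p' r'.2 r'.1 P4).
rewrite /matching_ok !no_rainbow ?no_large //; apply: perm_sumnP => k /=; clear; lia.
Qed.

(** The opposite edge abc gives the bounds 6 and 4; if x has more than 6 sets in its link, the other
    two links are empty and [link_le9] applies. *)
Lemma side_ok x y z a b c : uniq [:: a; b; c; y; x; z] -> {subset [:: a; b; c; y; x; z] <= U} ->
  [set a; b; c] \in F -> [set x; y; z] \in F -> g y <= g x -> g z <= g y ->
  (level (g x), level (g y), level (g z)) \in sides /\
  g x + g y + g z <= side_bound (level (g x)) (level (g y)) (level (g z)).
Proof.
move=> Us sU Fabc Fxyz le_yx le_zy.
have Us5 : uniq [:: a; b; c; y; x].
  exact: subseq_uniq (prefix_subseq [:: a; b; c; y; x] [:: z]) Us.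
have sU5 : {subset [:: a; b; c; y; x] <= U}.
  by move=> u /(mem_subseq (prefix_subseq [:: a; b; c; y; x] [:: z])); apply: sU.
have le6 : 0 < g y -> g x <= 6 := link_le6 Us5 sU5 Fabc.
have le4 : 1 < g y -> g x <= 4 := link_le4 Us5 sU5 Fabc.
apply: side_levels => //; have [/leq_trans->//|gt6] := leqP (g x) 6.
have gy0 : g y = 0 by case: (posnP (g y)) => // /le6; rewrite leqNgt gt6.
have gz0 : g z = 0 by apply/eqP; rewrite -leqn0 -gy0.
apply: (link_le9 Fxyz).
- by rewrite !subUset !sub1set !sU ?inE ?eqxx ?orbT.
- by rewrite !inE eqxx.
by move=> u; rewrite !inE -orbA => /or3P[]/eqP-> //; rewrite eqxx.
Qed.

Lemma base_v : base = [:: v 0; v 1; v 2; v 3; v 4; v 5].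
Proof.
have := map_nth_iota0 a0 (leqnn (size base)); rewrite take_size => {1}<-.
by rewrite size_base.
Qed.

Lemma by_degree_v : by_degree A = [:: v 0; v 1; v 2] /\ by_degree B = [:: v 3; v 4; v 5].
Proof.
have := base_v; rewrite /base; have := size_by_degree FA; have := size_by_degree FB.
case: (by_degree A) (by_degree B) => [|x1 [|x2 [|x3 [|? ?]]]] // [|y1 [|y2 [|y3 [|? ?]]]] // _ _.
by case=> -> -> -> -> -> ->.
Qed.

Lemma set_by_degree E : E = [set x in by_degree E].
Proof. by apply/setP=> x; rewrite inE mem_sort mem_enum. Qed.

Lemma tA : t [:: 0; 1; 2].
Proof. by rewrite /t /= -by_degree_v.1 -set_by_degree. Qed.

Lemma tB : t [:: 3; 4; 5].
Proof. by rewrite /t /= -by_degree_v.2 -set_by_degree. Qed.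

Lemma by_degree_sorted E : sorted (fun x y => g y <= g x) (by_degree E).
Proof. by apply: sort_sorted => x y; apply: leq_total. Qed.

Lemma sideA : (l 0, l 1, l 2) \in sides /\
  g (v 0) + g (v 1) + g (v 2) <= side_bound (l 0) (l 1) (l 2).
Proof.
have := by_degree_sorted A; rewrite by_degree_v.1 /= => /and3P[le1 le2 _].
apply: (@side_ok _ _ _ (v 3) (v 4) (v 5)) => //; rewrite -?tE ?tA ?tB //.
  exact: (@uniq_v [:: 3; 4; 5; 1; 0; 2]).
exact: (@sub_v [:: 3; 4; 5; 1; 0; 2]).
Qed.

Lemma sideB : (l 3, l 4, l 5) \in sides /\
  g (v 3) + g (v 4) + g (v 5) <= side_bound (l 3) (l 4) (l 5).
Proof.
have := by_degree_sorted B; rewrite by_degree_v.2 /= => /and3P[le1 le2 _].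
apply: (@side_ok _ _ _ (v 0) (v 1) (v 2)) => //; rewrite -?tE ?tA ?tB //.
  exact: (@uniq_v [:: 0; 1; 2; 4; 3; 5]).
exact: (@sub_v [:: 0; 1; 2; 4; 3; 5]).
Qed.

(** For x of level 4, [link_gt6] gives a second vertex c with a nonempty link and then, avoiding
    both x and c, a third one. *)
Lemma three_positive : 4 \in ls -> 2 < count (fun i => 0 < i) ls.
Proof.
have -> : ls = [seq level (g x) | x <- base] by rewrite base_v.
case/mapP=> x; rewrite mem_base => Ux /eq_leq; rewrite level_ge // => gt6.
have [c [Uc cx _ gc]] := link_gt6 Ux Ux gt6.
have [d [Ud dx dc gd]] := link_gt6 Ux Uc gt6.
rewrite count_map -size_filter; apply: (@uniq_leq_size _ [:: x; c; d]).
  by rewrite /= !inE negb_or ![x == _]eq_sym cx dx eq_sym dc.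
move=> u; rewrite mem_filter mem_base /= level_ge //= !inE.
case/or3P=> /eqP->; rewrite ?gc ?gd ?(leq_trans _ gt6) //=; [move: Ux | move: Uc | move: Ud];
  by rewrite in_setU.
Qed.

Lemma total_le : weight t h + (side_bound (l 0) (l 1) (l 2) + side_bound (l 3) (l 4) (l 5)) <= 56.
Proof.
have [sA _] := sideA; have [sB _] := sideB.
have C : check (l 0, l 1, l 2) (l 3, l 4, l 5) := allP (allP check_all _ sA) _ sB.
have S : search l [seq (m, table l m) | m <- perfect_matchings]
    (56 - side_bound (l 0) (l 1) (l 2) - side_bound (l 3) (l 4) (l 5)) pairs [::].
  exact: (@check_search (l 0, l 1, l 2) (l 3, l 4, l 5) three_positive C).
have le : weight t h <= 56 - side_bound (l 0) (l 1) (l 2) - side_bound (l 3) (l 4) (l 5).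
  exact: (@search_sound l t h t_perm h_le4 edge_okP matching_okP tA tB _ [::] pairs (erefl _) S).
have := side_bound_le sA; have := side_bound_le sB => /= b1 b2.
rewrite addnC -leq_subRL ?subnDA // -[56]/(28 + 28); exact: leq_add.
Qed.

(** * Counting the edges by their trace on U *)

Lemma triples_mem r : sorted ltn r -> all (ltn^~ 6) r -> size r = 3 -> r \in triples.
Proof.
case: r => [|i [|j [|k []]]] // Sr /= /and4P[li lj lk _] _.
rewrite mem_filter Sr andTb; apply/allpairsP; exists ((i, j), k); split; [|by rewrite mem_iota|by []].
by apply/allpairsP; exists (i, j); rewrite !mem_iota.
Qed.

Lemma pairs_mem i j : i < j -> j < 6 -> (i, j) \in pairs.
Proof.
have C : all (fun i => all (fun j => (i < j) ==> ((i, j) \in pairs)) (iota 0 6)) (iota 0 6).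
  by vm_compute.
move=> ltij ltj; move: C => /allP/(_ i); rewrite mem_iota (ltn_trans ltij) // => /(_ isT).
by move=> /allP/(_ j); rewrite mem_iota ltj => /(_ isT)/implyP; apply.
Qed.

(** Every edge meets U in three, two or one points, and so occurs in [L3], [L2] or [L1]
    respectively. *)
Lemma card_F : #|F| <= weight t h + sumn [seq g (v i) | i <- iota 0 6].
Proof.
pose L3 := [seq [set x in [seq v i | i <- r]] | r <- triples & t r].
pose L2 := [seq [seq [set v p.1; v p.2; w] | w <- enum (outer (v p.1) (v p.2))] | p <- pairs].
pose L1 := [seq [seq v i |: e | e : {set V} <- enum (link (v i))] | i <- iota 0 6].
have sz : size (L3 ++ flatten L2 ++ flatten L1) =
    weight t h + sumn [seq g (v i) | i <- iota 0 6].
  rewrite size_cat [X in _ + X]size_cat 2!size_flatten /shape -!map_comp size_map size_filter addnA.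
  by congr (_ + sumn _ + sumn _); apply: eq_map => p /=; rewrite size_map -cardE.
rewrite -sz; apply: leq_trans (card_size _); apply/subset_leq_card/subsetP=> E FE.
pose r := [seq i <- iota 0 6 | v i \in E].
have r6 : all (ltn^~ 6) r by apply/allP=> i; rewrite mem_filter mem_iota => /andP[].
have Sr : sorted ltn r by apply: sorted_filter; [apply: ltn_trans | apply: iota_ltn_sorted].
have Ur : uniq [seq v i | i <- r].
  by apply: uniq_v => //; apply: filter_uniq; apply: iota_uniq.
have EU : E :&: U = [set x in [seq v i | i <- r]].
  apply/setP=> x; rewrite !inE -in_setU -/U -mem_base; apply/andP/mapP.
    case=> Ex bx; exists (index x base); last by rewrite /v nth_index.
    by rewrite mem_filter mem_iota /v nth_index // Ex -size_base index_mem.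
  by case=> i; rewrite mem_filter mem_iota => /andP[Ei /= li] ->; rewrite mem_nth ?size_base.
have szr : #|E :&: U| = size r by rewrite EU cardsE (card_uniqP Ur) size_map.
have sum3 : size r + #|E :\: U| = 3 by rewrite -szr cardsID F_card.
have [c Uc Ec] := meetsU FE.
have r_gt0 : 0 < size r by rewrite -szr; apply/card_gt0P; exists c; rewrite inE Ec.
have DU : [disjoint E :\: U & U] by apply: disjoint_notin => z; rewrite inE => /andP[].
have EE : E = [set x in [seq v i | i <- r]] :|: (E :\: U) by rewrite -EU setID.
rewrite mem_cat [X in _ || X]mem_cat.
case def_r: r => [|i [|j [|k [|? ?]]]]; rewrite def_r in r_gt0 sum3 EE Sr r6 => //.
- apply/orP; right; apply/orP; right; apply/flattenP.
  have li : i < 6 by case/andP: r6.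
  exists [seq v i |: e | e : {set V} <- enum (link (v i))].
    by apply/mapP; exists i; rewrite ?mem_iota.
  have Ei : E = v i |: (E :\: U) by rewrite {1}EE; congr (_ :|: _); apply/setP=> x; rewrite !inE.
  apply/mapP; exists (E :\: U); rewrite // mem_enum inE -Ei FE DU !andbT.
  by move: sum3; rewrite /= add1n => -[->].
- apply/orP; right; apply/orP; left; apply/flattenP.
  have [/andP[ltij _] /and3P[_ lj _]] := (Sr, r6).
  exists [seq [set v i; v j; w] | w <- enum (outer (v i) (v j))].
    by apply/mapP; exists (i, j); rewrite ?pairs_mem.
  have /eqP/cards1P[w Ew] : #|E :\: U| = 1 by move: sum3; rewrite /= add2n => -[].
  have Ei : E = [set v i; v j; w] by rewrite {1}EE Ew; apply/setP=> x; rewrite /= !inE ?orbA.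
  apply/mapP; exists w; rewrite // mem_enum inE -Ei FE andbT.
  by rewrite (disjointFr DU) // Ew set11.
- apply/orP; left; apply/mapP; exists [:: i; j; k]; last first.
    rewrite {1}EE; have /eqP : #|E :\: U| = 0 by move: sum3; rewrite /= add3n => -[].
    by rewrite cards_eq0 => /eqP->; rewrite setU0.
  rewrite mem_filter triples_mem // andbT /t.
  have /eqP : #|E :\: U| = 0 by move: sum3; rewrite /= add3n => -[].
  by rewrite cards_eq0 => /eqP E0; rewrite E0 setU0 in EE; rewrite -EE.
Qed.

Lemma card_F_le56 : #|F| <= 56.
Proof.
apply: leq_trans card_F (leq_trans _ total_le); rewrite leq_add2l.
have [_ leA] := sideA; have [_ leB] := sideB.
by apply: leq_trans (leq_add leA leB); rewrite /= addn0 !addnA.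
Qed.
End Base.
End Triple.

(** * Matchings, and the complete 3-graph on 8 points *)

Lemma matching_le n (F M : {set {set 'I_n}}) :
  M \subset F -> trivIset M -> #|M| <= matching_number F.
Proof.
move=> sMF tM; apply: (@leq_bigmax_cond _ _ (fun M : {set {set 'I_n}} => #|M|)).
by rewrite powersetE sMF.
Qed.

Lemma matching_attained n (F : {set {set 'I_n}}) :
  exists M : {set {set 'I_n}}, [/\ M \subset F, trivIset M & #|M| = matching_number F].
Proof.
pose P := [pred M : {set {set 'I_n}} | (M \in powerset F) && trivIset M].
have P0 : 0 < #|P|.
  apply/card_gt0P; exists set0; rewrite inE powersetE sub0set.
  by apply/trivIsetP=> C D; rewrite inE.
have [M] := eq_bigmax_cond (fun M : {set {set 'I_n}} => #|M|) P0.
by rewrite inE powersetE => /andP[sMF tM] E; exists M; split.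
Qed.

Lemma card_le56 n (F : {set {set 'I_n}}) : admissible 3 2 F -> #|F| <= 56.
Proof.
case=> /forall_inP /= F_card F_res nu2.
have card3 E : E \in F -> #|E| = 3 by move=> /F_card/eqP.
have no3 C D E : C \in F -> D \in F -> E \in F ->
    [disjoint C & D] -> [disjoint C & E] -> [disjoint D & E] -> False.
  move=> FC FD FE CD CE DE.
  have neq (X Y : {set 'I_n}) : X \in F -> [disjoint X & Y] -> X != Y.
    move=> FX XY; apply: contraTneq XY => <-; rewrite -setI_eq0 setIid -cards_eq0.
    by rewrite card3.
  have : #|[set C; D; E]| <= matching_number F.
    apply: matching_le; first by rewrite !subUset !sub1set FC FD FE.
    apply/trivIsetP=> X Y; rewrite !inE -!orbA.
    by do 2![case/or3P=> /eqP->]; rewrite ?eqxx // => _; rewrite // disjoint_sym.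
  by rewrite nu2 -setUA !cardsU1 cards1 !inE negb_or !neq.
have res (T : {set 'I_n}) : #|T| <= 2 -> exists C D,
    [/\ C \in F, D \in F, [disjoint C & D], [disjoint C & T] & [disjoint D & T]].
  move=> /F_res; rewrite nu2; have [M [sM tM <-] /eqP/cards2P[C [D [nCD EM]]]] :=
    matching_attained (avoiding F T).
  move: sM; rewrite EM subUset !sub1set !inE !setI_eq0 => /andP[/andP[FC CT] /andP[FD DT]].
  by exists C, D; split=> //; apply: (trivIsetP tM); rewrite ?EM ?set21 ?set22.
(* The base edges A and B come from deleting nothing. *)
have [|A [B [FA FB AB _ _]]] := res set0; first by rewrite cards0.
have /card_gt0P[a0 a0A] : 0 < #|A| by rewrite card3.
exact: card_F_le56 card3 no3 res A B FA FB AB a0 a0A.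
Qed.

Definition complete3 : {set {set 'I_8}} := [set E : {set 'I_8} | #|E| == 3].

Lemma matching_complete3 (T : {set 'I_8}) : #|T| <= 2 ->
  matching_number (avoiding complete3 T) = 2.
Proof.
move=> leT; apply/eqP; rewrite eqn_leq; apply/andP; split.
  apply/bigmax_leqP=> M /andP[]; rewrite powersetE => /subsetP sM /eqP tM.
  (* Disjoint triples cover 3 * #|M| of the 8 points, whence #|M| < 3. *)
  have : \sum_(E in M) #|E| = 3 * #|M|.
    rewrite mulnC -sum_nat_const; apply: eq_bigr => E /sM.
    by rewrite !inE => /andP[/eqP].
  rewrite tM => cM; have := max_card (cover M); rewrite cM card_ord => le8.
  by have : 3 * #|M| < 3 * 3 by []; rewrite ltn_pmul2l.
(* At least six points survive the deletion of T; the first three and the next three form disjoint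
   edges. *)
have szT : 6 <= size (enum (~: T)).
  by rewrite -cardE; have := cardsC T; rewrite card_ord => E; rewrite -(leq_add2l #|T|) E (leq_add leT).
set s := enum _ in szT.
have Us : uniq (take 3 s ++ take 3 (drop 3 s)).
  have : uniq (take 3 s ++ drop 3 s) by rewrite cat_take_drop enum_uniq.
  by apply: subseq_uniq; apply: cat_subseq => //; apply: take_subseq.
move: Us; rewrite cat_uniq => /and3P[U1 N U2].
pose C := [set x in take 3 s]; pose D := [set x in take 3 (drop 3 s)].
have cC : #|C| = 3 by rewrite cardsE (card_uniqP U1) size_takel // (leq_trans _ szT).
have cD : #|D| = 3 by rewrite cardsE (card_uniqP U2) size_takel // size_drop leq_subRL ?(leq_trans _ szT).
have CT : C :&: T = set0.
  apply/eqP; rewrite setI_eq0; apply: disjoint_notin => z; rewrite inE => /mem_take.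
  by rewrite mem_enum inE.
have DT : D :&: T = set0.
  apply/eqP; rewrite setI_eq0; apply: disjoint_notin => z; rewrite inE => /mem_take/mem_drop.
  by rewrite mem_enum inE.
have CD : [disjoint C & D].
  apply: disjoint_notin => z; rewrite !inE => zC; apply: contra N => zD.
  by apply/hasP; exists z.
have nCD : C != D.
  by apply: contraTneq CD => <-; rewrite -setI_eq0 setIid -cards_eq0 cC.
have c2 : #|[set C; D]| = 2 by rewrite cards2 nCD.
rewrite -[X in X <= _]c2; apply: matching_le.
  by rewrite subUset !sub1set !inE cC cD CT DT !eqxx.
apply/trivIsetP=> X Y; rewrite !inE.
by do 2![case/orP=> /eqP->]; rewrite ?eqxx // => _; rewrite // disjoint_sym.
Qed.

Theorem theorem1p6 : is_m 3 2 'C(8, 3) /\ 'C(8, 3) = 56.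
Proof.
have E56 : 'C(8, 3) = 56 by [].
rewrite E56; split=> //; split=> [|n _ F]; last exact: card_le56.
have avoid0 : avoiding complete3 set0 = complete3.
  by apply/setP=> E; rewrite inE setI0 eqxx andbT.
have nu2 : matching_number complete3 = 2.
  by rewrite -avoid0 matching_complete3 // cards0.
exists 8; split=> //; exists complete3; split; last by rewrite card_draws card_ord.
split=> //; first by apply/forall_inP=> E; rewrite inE.
by move=> T leT; rewrite nu2 matching_complete3.
Qed.
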